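(* Let $p$ be a prime, $r\geq1$, $R=\mathbb{Z}/p^r\mathbb{Z}$, and let $m\geq0$ be an integer. For $M\in M_{2\times m}(R)$ with rows $x,y\in R^m$, put $$L_M=Rx+Ry\leq R^m,\qquad\varepsilon_M=x\wedge y\in\bigwedge\nolimits_R^2L_M.$$ The assignment $M\mapsto(L_M,\varepsilon_M)$ induces a bijection $$\mathrm{SL}_2(R)\backslash M_{2\times m}(R)\ \xrightarrow{\ \sim\ }\ \{\text{oriented two-generated submodules of }R^m\},$$ where $\mathrm{SL}_2(R)$ acts on $M_{2\times m}(R)$ by left multiplication.
   Context: An oriented two-generated submodule of $R^m$ is a pair $(L,\varepsilon)$, where $L\leq R^m$ is an $R$-submodule generated by at most two elements and $\varepsilon$ is a generator of the (cyclic) $R$-module $\bigwedge_R^2L$, the second exterior power of $L$ over $R$ (of the module $L$ itself, not its image in $\bigwedge^2R^m$). When this exterior square is zero, its zero element is regarded as its unique generator. *)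

(* Defs.v *)
From HB Require Import structures.
From mathcomp Require Import all_boot all_algebra.

Set Implicit Arguments.
Unset Strict Implicit.
Unset Printing Implicit Defensive.

Import GRing.Theory.
Local Open Scope ring_scope.
Local Open Scope quotient_scope.

Section Submodule.

Variables (R : finComNzRingType) (V : finLmodType R).

(* Everything is finite, so submodules are boolean-axiomatised finite sets: two
   of them are equal as soon as their carriers are. *)
Definition is_submodule (W : {set V}) : bool :=
  (0 \in W) && [forall a : R, forall u : V, forall v : V,
    (u \in W) ==> (v \in W) ==> (a *: u + v \in W)].

Lemma is_submoduleP (W : {set V}) :
  reflect (submod_closed (mem W)) (is_submodule W).
Proof.
apply: (iffP andP) => [[W0 /forallP WZ]|[W0 WZ]]; split => //.
  move=> a u v uW vW; have /forallP/(_ u)/forallP/(_ v) := WZ a.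
  by move=> /implyP/(_ uW)/implyP/(_ vW).
apply/forallP=> a; apply/forallP=> u; apply/forallP=> v.
by apply/implyP=> uW; apply/implyP=> vW; apply: WZ.
Qed.

Record submodule := Submodule {
  submodule_set :> {set V};
  submodule_axiom : is_submodule submodule_set
}.

HB.instance Definition _ := [isSub for submodule_set].
HB.instance Definition _ := [Finite of submodule by <:].

Definition in_submodule (W : submodule) : {pred V} := fun v => v \in val W.

Lemma in_submodule_closed (W : submodule) : submod_closed (in_submodule W).
Proof. by case: (is_submoduleP _ (submodule_axiom W)). Qed.

HB.instance Definition _ (W : submodule) :=
  GRing.isSubmodClosed.Build R V (in_submodule W)
    (GRing.submod_closed_semi (in_submodule_closed W)).

Definition submodule_type (W : submodule) : Type := {v : V | in_submodule W v}.

HB.instance Definition _ (W : submodule) := [isSub of submodule_type W for @sval _ _].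
HB.instance Definition _ (W : submodule) := [Finite of submodule_type W by <:].
HB.instance Definition _ (W : submodule) :=
  [SubChoice_isSubLmodule of submodule_type W by <:].

Definition span_set (S : {set V}) : {set V} :=
  \bigcap_(W : submodule | S \subset W) W.

Lemma span_set_submodule (S : {set V}) : is_submodule (span_set S).
Proof.
apply/is_submoduleP; split=> [|a u v].
  by apply/bigcapP=> W _; have [] := in_submodule_closed W.
move=> /bigcapP uW /bigcapP vW; apply/bigcapP=> W SW.
by have [_] := in_submodule_closed W; apply; [apply: uW|apply: vW].
Qed.

Definition span (S : {set V}) : submodule := Submodule (span_set_submodule S).

Definition two_generated (L : submodule) : bool :=
  [exists S : {set V}, (#|S| <= 2)%N && (L == span S)].

(* R x + R y *)
Definition span2_set (x y : V) : {set V} :=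
  [set a *: x + b *: y | a in R, b in R].

Lemma span2_setP (x y v : V) :
  reflect (exists a b : R, v = a *: x + b *: y) (v \in span2_set x y).
Proof.
apply: (iffP imset2P) => [[a b _ _ ->]|[a [b ->]]]; first by exists a, b.
by exists a b.
Qed.

Lemma span2_set_submodule (x y : V) : is_submodule (span2_set x y).
Proof.
apply/is_submoduleP; split=> [|c u v].
  by apply/span2_setP; exists 0, 0; rewrite !scale0r addr0.
move=> /span2_setP[a [b ->]] /span2_setP[a' [b' ->]].
apply/span2_setP; exists (c * a + a'), (c * b + b').
by rewrite !scalerDl scalerDr !scalerA addrACA.
Qed.

Definition span2 (x y : V) : submodule := Submodule (span2_set_submodule x y).

Lemma mem_span2l (x y : V) : in_submodule (span2 x y) x.
Proof. by apply/span2_setP; exists 1, 0; rewrite scale1r scale0r addr0. Qed.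

Lemma mem_span2r (x y : V) : in_submodule (span2 x y) y.
Proof. by apply/span2_setP; exists 0, 1; rewrite scale1r scale0r add0r. Qed.

Lemma span2E (x y : V) : span2 x y = span [set x; y].
Proof.
apply/val_inj/eqP; rewrite /= eqEsubset; apply/andP; split.
  apply/subsetP=> v /span2_setP[a [b ->]]; apply/bigcapP=> W.
  rewrite subUset !sub1set => /andP[xW yW].
  have /(rpredZ a) axW : x \in in_submodule W by [].
  have /(rpredZ b) byW : y \in in_submodule W by [].
  exact: rpredD axW byW.
apply: (bigcap_inf (span2 x y)).
by rewrite subUset !sub1set; apply/andP; split; [apply: mem_span2l|apply: mem_span2r].
Qed.

Lemma two_generatedP (L : submodule) :
  reflect (exists x y : V, L = span2 x y) (two_generated L).
Proof.
apply: (iffP existsP) => [[S /andP[S2 /eqP->]]|[x [y ->]]]; last first.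
  exists [set x; y]; rewrite span2E eqxx andbT cards2.
  by case: (_ == _).
have span1 x : span [set x] = span2 x x by rewrite span2E setUid.
have span0 : span set0 = span2 0 0.
  apply/val_inj/eqP; rewrite span2E /= eqEsubset; apply/andP; split.
    apply/bigcapsP=> W _; apply: bigcap_inf; exact: sub0set.
  apply/bigcapsP=> W _; apply: (bigcap_inf W).
  by rewrite setUid sub1set; have [] := in_submodule_closed W.
move: S2; rewrite leq_eqVlt ltnS leq_eqVlt ltnS leqn0.
case/or3P=> [/cards2P[x [y [_ ->]]]|/cards1P[x ->]|].
- by exists x, y; rewrite span2E.
- by exists x, x.
- by rewrite cards_eq0 => /eqP->; exists 0, 0.
Qed.

End Submodule.

Section QuotientModule.

Variables (R : finComNzRingType) (V : finLmodType R) (W : submodule V).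

Definition quotmod : Type := Quotient.quot (in_submodule W).

HB.instance Definition _ := GRing.Zmodule.on quotmod.
HB.instance Definition _ := EqQuotient.on quotmod.
HB.instance Definition _ :=
  @isZmodQuotient.Build V (Quotient.equiv (in_submodule W)) 0 -%R +%R quotmod
    (lock _) (@Quotient.pi_opp _ _) (@Quotient.pi_add _ _).
HB.instance Definition _ : isCountable quotmod :=
  CanIsCountable (@reprK _ quotmod).
HB.instance Definition _ : isFinite quotmod := CanIsFinite (@reprK _ quotmod).

Definition quotmod_scale (a : R) : quotmod -> quotmod :=
  lift_op1 quotmod ( *:%R a).

Lemma pi_quotmodP (u v : V) :
  reflect (\pi_quotmod u = \pi_quotmod v) (u - v \in in_submodule W).
Proof. by rewrite Quotient.idealrBE; apply: eqP. Qed.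

Lemma pi_quotmod_scale (a : R) :
  {morph \pi_quotmod : u / a *: u >-> quotmod_scale a u}.
Proof.
move=> u; unlock quotmod_scale; apply/pi_quotmodP.
rewrite -scalerBr; apply: rpredZ; apply/pi_quotmodP.
by rewrite reprK.
Qed.

Let scaleA a b u : quotmod_scale a (quotmod_scale b u) = quotmod_scale (a * b) u.
Proof. by rewrite -[u]reprK -!pi_quotmod_scale scalerA. Qed.
Let scale1 : left_id 1 quotmod_scale.
Proof. by move=> u; rewrite -[u]reprK -!pi_quotmod_scale scale1r. Qed.
Let scaleDr : right_distributive quotmod_scale +%R.
Proof.
move=> a u v; rewrite -[u]reprK -[v]reprK -!pi_quotmod_scale -!raddfD /=.
by rewrite -pi_quotmod_scale scalerDr.
Qed.
Let scaleDl u : {morph quotmod_scale^~ u : a b / a + b}.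
Proof.
by move=> a b; rewrite -[u]reprK -!pi_quotmod_scale -raddfD /= scalerDl.
Qed.

HB.instance Definition _ :=
  GRing.Zmodule_isLmodule.Build R quotmod scaleA scale1 scaleDr scaleDl.

Lemma pi_quotmodZ (a : R) (u : V) :
  \pi_quotmod (a *: u) = a *: \pi_quotmod u.
Proof. exact: pi_quotmod_scale. Qed.

End QuotientModule.

Section ExteriorSquare.

Variables (R : finComNzRingType) (E : finLmodType R).

(* The exterior square of E is the quotient of the free R-module on E * E by the
   relations making the classes of the basis vectors bilinear and alternating;
   see [ext2_universal]. *)
Definition free2 : Type := {ffun E * E -> R^o}.

HB.instance Definition _ := GRing.Lmodule.on free2.
HB.instance Definition _ := Finite.on free2.

Definition free2_base (u v : E) : free2 := [ffun w => (w == (u, v))%:R].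

Definition ext2_relations : {set free2} :=
  [set f : free2 | [|| [exists a : R, exists u : E, exists u' : E, exists v : E,
           f == free2_base (a *: u + u') v
                - (a *: free2_base u v + free2_base u' v)],
         [exists a : R, exists u : E, exists v : E, exists v' : E,
           f == free2_base u (a *: v + v')
                - (a *: free2_base u v + free2_base u v')]
       | [exists u : E, f == free2_base u u]]].

Definition ext2 : Type := quotmod (span ext2_relations).

HB.instance Definition _ := GRing.Lmodule.on ext2.
HB.instance Definition _ := Finite.on ext2.

Definition wedge (u v : E) : ext2 :=
  \pi_(quotmod (span ext2_relations)) (free2_base u v).


Definition generates (e : ext2) : bool :=
  [forall w : ext2, [exists a : R, w == a *: e]].

Lemma pi_relation (f : free2) :
  f \in ext2_relations -> \pi_(quotmod (span ext2_relations)) f = 0.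
Proof.
move=> fP; rewrite -(raddf0 \pi_(quotmod (span ext2_relations))).
apply/pi_quotmodP; rewrite subr0; apply/bigcapP=> W; by move=> /subsetP; apply.
Qed.

Lemma wedgeDZl (a : R) (u u' v : E) :
  wedge (a *: u + u') v = a *: wedge u v + wedge u' v.
Proof.
apply/eqP; rewrite -subr_eq0 -pi_quotmodZ -!raddfD -raddfB; apply/eqP.
apply: pi_relation; rewrite inE; apply/orP; left.
by do 4![apply/existsP; eexists].
Qed.

Lemma wedgeDZr (a : R) (u v v' : E) :
  wedge u (a *: v + v') = a *: wedge u v + wedge u v'.
Proof.
apply/eqP; rewrite -subr_eq0 -pi_quotmodZ -!raddfD -raddfB; apply/eqP.
apply: pi_relation; rewrite inE; apply/or3P; apply: Or32.
by do 4![apply/existsP; eexists].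
Qed.

Lemma wedge_diag (u : E) : wedge u u = 0.
Proof.
by apply: pi_relation; rewrite inE; apply/or3P/Or33/existsP; exists u.
Qed.

Lemma free2E (f : free2) : f = \sum_(w : E * E) f w *: free2_base w.1 w.2.
Proof.
apply/ffunP=> w; rewrite sum_ffunE (bigD1 w) //= big1 ?addr0 => [|z zw].
  by rewrite !ffunE -surjective_pairing eqxx; exact/esym/mulr1.
by rewrite !ffunE -surjective_pairing eq_sym (negPf zw); exact: mulr0.
Qed.

Lemma ext2E (e : ext2) :
  exists f : free2, e = \sum_(w : E * E) f w *: wedge w.1 w.2.
Proof.
exists (repr (e : quotmod (span ext2_relations))).
rewrite -[LHS](@reprK _ (quotmod (span ext2_relations))) [in LHS](free2E (repr _)).
rewrite raddf_sum /=; apply: eq_bigr => w _; exact: pi_quotmodZ.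
Qed.

Lemma ext2_universal (N : lmodType R) (f : E -> E -> N) :
    (forall a u u' v, f (a *: u + u') v = a *: f u v + f u' v) ->
    (forall a u v v', f u (a *: v + v') = a *: f u v + f u v') ->
    (forall u, f u u = 0) ->
  exists g : {linear ext2 -> N}, forall u v, g (wedge u v) = f u v.
Proof.
move=> fl fr ff.
pose h (x : free2) : N := \sum_(w : E * E) (x w : R) *: f w.1 w.2.
have hlin a x y : h (a *: x + y) = a *: h x + h y.
  rewrite /h scaler_sumr -big_split; apply: eq_bigr => w _ /=.
  by rewrite !ffunE scalerDl scalerA.
have h0 : h 0 = 0 by rewrite /h big1 // => w _; rewrite ffunE scale0r.
have hZ a x : h (a *: x) = a *: h x by rewrite -[a *: x]addr0 hlin h0 addr0.
have hD x y : h (x + y) = h x + h y by rewrite -[x]scale1r hlin !scale1r.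
have hB x y : h (x - y) = h x - h y by rewrite hD -(@scaleN1r R free2) hZ scaleN1r.
have hb u v : h (free2_base u v) = f u v.
  rewrite /h (bigD1 (u, v)) //= big1 ?addr0 => [|z zw].
    by rewrite ffunE eqxx scale1r.
  by rewrite ffunE (negPf zw) scale0r.
pose K := [set x : free2 | h x == 0].
have Ksub : is_submodule K.
  apply/is_submoduleP; split=> [|a x y]; rewrite !inE ?h0 //.
  by move=> /eqP x0 /eqP y0; rewrite hlin x0 y0 scaler0 addr0.
have relK x : x \in span ext2_relations -> h x = 0.
  move=> /bigcapP/(_ (Submodule Ksub)); rewrite /= inE => xK; apply/eqP/xK.
  apply/subsetP=> z; rewrite !inE => /or3P[].
  - move=> /existsP[a /existsP[u /existsP[u' /existsP[v /eqP->]]]].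
    by rewrite hB hD hZ !hb fl subrr.
  - move=> /existsP[a /existsP[u /existsP[v /existsP[v' /eqP->]]]].
    by rewrite hB hD hZ !hb fr subrr.
  - by move=> /existsP[u /eqP->]; rewrite hb ff.
pose Q := quotmod (span ext2_relations).
pose g (x : ext2) : N := h (repr (x : Q)).
have gpi x : g (\pi_Q x) = h x.
  apply/eqP; rewrite -subr_eq0 -hB; apply/eqP/relK/pi_quotmodP.
  by rewrite reprK.
have glin : linear g.
  move=> a x y; rewrite -[x](@reprK _ Q) -[y](@reprK _ Q).
  by rewrite -pi_quotmodZ -raddfD !gpi hlin.
pose G := GRing.isLinear.Build R ext2 N *:%R g glin.
by exists (HB.pack_for {linear ext2 -> N} g G) => u v /=; rewrite gpi hb.
Qed.

End ExteriorSquare.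

Section Oriented.

Variables (R : finComNzRingType) (V : finLmodType R).

(* The orientation lives in the exterior square of the abstract module L, not in
   that of V. If that exterior square is zero, 0 generates it. *)
Record oriented_submodule := OrientedSubmodule {
  os_module : submodule V;
  os_two_generated : two_generated os_module;
  os_orientation : ext2 (submodule_type os_module);
  os_generates : generates os_orientation
}.

Definition span2_l (x y : V) : submodule_type (span2 x y) :=
  exist _ x (mem_span2l x y).

Definition span2_r (x y : V) : submodule_type (span2 x y) :=
  exist _ y (mem_span2r x y).

Definition span2_wedge (x y : V) : ext2 (submodule_type (span2 x y)) :=
  wedge (span2_l x y) (span2_r x y).

Lemma span2_two_generated (x y : V) : two_generated (span2 x y).
Proof. by apply/two_generatedP; exists x, y. Qed.

Lemma span2_typeP (x y : V) (u : submodule_type (span2 x y)) :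
  exists a b : R, u = a *: span2_l x y + b *: span2_r x y.
Proof.
have /span2_setP[a [b e]] := valP u; exists a, b; apply: val_inj.
by rewrite e.
Qed.

Lemma span2_generates (x y : V) : generates (span2_wedge x y).
Proof.
have wP u v : exists c : R, wedge u v = c *: span2_wedge x y.
  have [a [b ->]] := span2_typeP u; have [c [d ->]] := span2_typeP v.
  set X := span2_l x y; set Y := span2_r x y.
  have Z1 (s : R) (z t : submodule_type (span2 x y)) :
      wedge z (s *: t) = s *: wedge z t.
    have w0 : wedge z 0 = 0.
      have := wedgeDZr 1 z 0 0; rewrite !scale1r addr0 => /eqP.
      by rewrite -subr_eq0 opprD addrA subrr sub0r oppr_eq0 => /eqP.
    by rewrite -[s *: t]addr0 wedgeDZr w0 addr0.
  have YX : wedge Y X = - wedge X Y.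
    apply/eqP; rewrite -addr_eq0; apply/eqP.
    have := wedge_diag (1 *: X + Y).
    rewrite wedgeDZl wedgeDZr (wedgeDZr 1 Y) !wedge_diag !scale1r add0r addr0.
    by rewrite addrC.
  have Z2 (s : R) (z t : submodule_type (span2 x y)) :
      wedge (s *: z) t = s *: wedge z t.
    have w0 : wedge 0 t = 0.
      have := wedgeDZl 1 0 0 t; rewrite !scale1r addr0 => /eqP.
      by rewrite -subr_eq0 opprD addrA subrr sub0r oppr_eq0 => /eqP.
    by rewrite -[s *: z]addr0 wedgeDZl w0 addr0.
  exists (a * d - b * c).
  rewrite wedgeDZl Z2 !wedgeDZr !Z1 !wedge_diag.
  rewrite !scaler0 add0r addr0 YX !scalerN !scalerA scalerBl.
  by congr (_ - _).
apply/forallP=> e; have [f ->] := ext2E e.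
elim/big_ind: _ => [|e1 e2 /existsP[a1 /eqP->] /existsP[a2 /eqP->]|[u v] _] /=.
- by apply/existsP; exists 0; rewrite scale0r.
- by apply/existsP; exists (a1 + a2); rewrite scalerDl.
- have [c ->] := wP u v; apply/existsP; exists (f (u, v) * c).
  by rewrite scalerA.
Qed.

End Oriented.

Section SL2Orbits.

Variables (R : finComNzRingType) (m : nat).

Definition SL2 : {set 'M[R]_2} := [set g | \det g == 1].

Definition SL2_equiv (M N : 'M[R]_(2, m)) : bool :=
  [exists g in SL2, N == g *m M].

Lemma SL2_equiv_is_equiv : equiv_class_of SL2_equiv.
Proof.
have tr : transitive SL2_equiv.
  move=> N M P /exists_inP[g gS /eqP->] /exists_inP[h hS /eqP->].
  apply/exists_inP; exists (h *m g); last by rewrite mulmxA.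
  by move: gS hS; rewrite !inE det_mulmx => /eqP-> /eqP->; rewrite mulr1.
have sy M N : SL2_equiv M N -> SL2_equiv N M.
  case/exists_inP=> g; rewrite inE => /eqP g1 /eqP->.
  have gg : \adj g *m g = 1%:M by rewrite mul_adj_mx g1.
  apply/exists_inP; exists (\adj g); last by rewrite mulmxA gg mul1mx.
  by rewrite inE -[X in X == _]mulr1 -[in X in X == _]g1 -det_mulmx gg det1.
split=> // [M|M N]; last by apply/idP/idP; apply: sy.
by apply/exists_inP; exists 1%:M; rewrite ?inE ?det1 ?mul1mx.
Qed.

Canonical SL2_equiv_equiv := EquivRelPack SL2_equiv_is_equiv.
Canonical SL2_equiv_encModRel := defaultEncModRel SL2_equiv.

(* SL_2(R) \ M_{2 x m}(R) *)
Definition SL2_quot : Type := {eq_quot SL2_equiv}.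

HB.instance Definition _ := EqQuotient.on SL2_quot.
HB.instance Definition _ := Choice.on SL2_quot.

Lemma SL2_quotP (M N : 'M[R]_(2, m)) :
  reflect (exists2 g : 'M[R]_2, \det g = 1 & N = g *m M)
          (\pi_SL2_quot M == \pi_SL2_quot N).
Proof.
rewrite eqmodE; apply: (iffP exists_inP) => [[g gS /eqP->]|[g gS ->]].
  by exists g => //; move: gS; rewrite inE => /eqP.
by exists g; rewrite // inE gS.
Qed.

(* M |-> (L_M, eps_M) *)
Definition oriented_rowspace (M : 'M[R]_(2, m)) :
    oriented_submodule 'rV[R]_m :=
  let x := row ord0 M in let y := row ord_max M in
  OrientedSubmodule (span2_two_generated x y) (span2_generates x y).

End SL2Orbits.

(* Main.v *)
Require Import Defs.
From mathcomp Require Import all_boot all_algebra.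
From mathcomp Require Import ring.

(** The argument works over any finite chain ring R (a commutative ring in which
    divisibility is total) and any finite R-module V in place of R^m; Z/p^r is
    a chain ring because each of its elements is associate to a power of p.

    Replacing (x, y) by g (x, y) keeps the span and multiplies the wedge by
    det g, so the map is constant on SL_2-orbits.

    Surjectivity ([oriented_pair_surj]).  If L = R x + R y, an orientation w and
    x /\ y both generate the exterior square of L, hence are multiples of each
    other: w = a (x /\ y) and x /\ y = b w.  As R is local, either b a is a
    unit, and w = (a x) /\ y with the same span, or 1 - b a is a unit, and then
    the exterior square is zero.

    Injectivity ([oriented_pair_inj]).  The coefficients occurring in the linear
    relations between x and y generate an ideal I, and the exterior square of L
    is R / I with x /\ y as the class of 1 ([wedge_annihilator] is the inclusion
    of the annihilator in I).  Since R is a chain ring, I = c R where c itself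
    is a coefficient of some relation; the other coefficient is a multiple of c,
    so that after a change of generators in SL_2 the relation becomes c y = 0
    ([normalize_pair]).  If (x', y') gives the same oriented submodule, then
    (x', y') = g (x, y) for some matrix g, and comparing wedges, det g = 1 mod c.
    The second column of g may be changed by multiples of c.  When the first
    column of g is unimodular, such a change alters the determinant by an
    arbitrary multiple of c, so it can be made equal to 1.  The first column
    is unimodular unless x = 0, in which case every vector in sight is zero
    ([normalized_pair_inj]). *)

Set Implicit Arguments.
Unset Strict Implicit.
Unset Printing Implicit Defensive.

Import GRing.Theory.
Local Open Scope ring_scope.
Local Open Scope quotient_scope.

(** * Finite chain rings *)

Section ChainRing.

Variable R : finComUnitRingType.

Definition chain_ring : Prop :=
  forall a b : R, (exists t, a = t * b) \/ (exists t, b = t * a).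

Hypothesis R_chain : chain_ring.

(** Chain rings are local: one of the two summands divides the other, hence
    divides the sum. *)
Lemma chain_ring_unitD (a b : R) :
  a + b \is a GRing.unit -> (a \is a GRing.unit) || (b \is a GRing.unit).
Proof.
case: (R_chain a b) => [[t ->]|[t ->]].
- by rewrite -[X in _ + X]mul1r -mulrDl unitrM => /andP[_ ->]; rewrite orbT.
- by rewrite -[X in X + _]mul1r -mulrDl unitrM => /andP[_ ->].
Qed.

(** The ideal generated by finitely many elements is generated by one of them;
    it matters below that the generator belongs to the family. *)
Lemma chain_ring_gen (s : seq R) : s != [::] ->
  exists2 c, c \in s & forall a, a \in s -> exists t, a = t * c.
Proof.
elim: s => // d s IHs _; have [->|/IHs[c cs cP]] := eqVneq s [::].
  by exists d; rewrite ?inE // => a; rewrite inE => /eqP->; exists 1; rewrite mul1r.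
have [[t dE]|[t cE]] := R_chain d c.
  exists c => [|a]; rewrite inE ?cs ?orbT //.
  by case/predU1P=> [->|/cP//]; exists t.
exists d => [|a]; rewrite inE ?eqxx //.
case/predU1P=> [->|/cP[u ->]]; first by exists 1; rewrite mul1r.
by exists (u * t); rewrite cE mulrA.
Qed.

End ChainRing.

(** * The exterior square of a module with two generators *)

Lemma scaler_comb2 (R : comNzRingType) (V : lmodType R) (x y : V)
    (a b a1 b1 a2 b2 : R) :
  a *: (a1 *: x + b1 *: y) + b *: (a2 *: x + b2 *: y)
    = (a * a1 + b * a2) *: x + (a * b1 + b * b2) *: y.
Proof. by rewrite !scalerDr !scalerA addrACA -!scalerDl. Qed.

Section Wedge.

Variables (R : finComNzRingType) (E : finLmodType R).

Lemma wedge0l (v : E) : wedge 0 v = 0.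
Proof.
by have := wedgeDZl (-1) v v v; rewrite !scaleN1r !addNr.
Qed.

Lemma wedge0r (u : E) : wedge u 0 = 0.
Proof.
by have := wedgeDZr (-1) u u u; rewrite !scaleN1r !addNr.
Qed.

Lemma wedgeC (u v : E) : wedge v u = - wedge u v.
Proof.
have := wedge_diag (1 *: u + v).
rewrite wedgeDZl !(wedgeDZr 1) !wedge_diag !scale1r add0r addr0 addrC => /eqP.
by rewrite addr_eq0 => /eqP.
Qed.

Lemma wedge_comb2 (x y : E) (a b c d : R) :
  wedge (a *: x + b *: y) (c *: x + d *: y) = (a * d - b * c) *: wedge x y.
Proof.
have Zr s u : wedge u (s *: y) = s *: wedge u y.
  by rewrite -[s *: y]addr0 wedgeDZr wedge0r addr0.
have Zl s u : wedge (s *: y) u = s *: wedge y u.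
  by rewrite -[s *: y]addr0 wedgeDZl wedge0l addr0.
rewrite wedgeDZl Zl !wedgeDZr !Zr !wedge_diag (wedgeC x y) !scaler0.
by rewrite add0r addr0 !scalerN !scalerA scalerBl.
Qed.

(** If all coefficients of relations between x and y lie in c R, then sending
    (a x + b y, a' x + b' y) to the class of a b' - b a' in R / c R is
    well-defined, bilinear and alternating.  The induced linear form maps the
    wedge of x and y to 1, whence t = 0 in R / c R. *)
Lemma wedge_annihilator (x y : E) (c t : R) :
    (forall u, exists a b, u = a *: x + b *: y) ->
    (forall a b, a *: x + b *: y = 0 ->
      (exists s, a = s * c) /\ (exists s, b = s * c)) ->
  t *: wedge x y = 0 -> exists s, t = s * c.
Proof.
move=> gen rel txy0.
have gen' u : exists ab : R * R, u == ab.1 *: x + ab.2 *: y.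
  by have [a [b ->]] := gen u; exists (a, b).
pose k u := xchoose (gen' u).
have kE u : u = (k u).1 *: x + (k u).2 *: y by apply/eqP/(xchooseP (gen' u)).
(* R / c R, with c R written as the span of c and 0 *)
pose K := span2 (c : R^o) 0.
pose q (z : R) : quotmod K := \pi_(quotmod K) (z : R^o).
have memK (z : R) : (exists s, z = s * c) -> (z : R^o) \in in_submodule K.
  by case=> s ->; apply/span2_setP; exists s, 0; rewrite scaler0 addr0.
pose f u v := q ((k u).1 * (k v).2 - (k u).2 * (k v).1).
have fE u v a b a' b' : u = a *: x + b *: y -> v = a' *: x + b' *: y ->
    f u v = q (a * b' - b * a').
  move=> uE vE; apply/pi_quotmodP/memK.
  have diff w e g : w = e *: x + g *: y ->
      (exists s, (k w).1 - e = s * c) /\ (exists s, (k w).2 - g = s * c).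
    move=> wE; apply: rel; rewrite !scalerBl addrACA -opprD.
    by rewrite -wE -kE subrr.
  have [[s1 e1] [s2 e2]] := diff _ _ _ uE.
  have [[s3 e3] [s4 e4]] := diff _ _ _ vE.
  exists (s1 * (k v).2 - s2 * (k v).1 + a * s4 - b * s3).
  rewrite [RHS](_ : _ = s1 * c * (k v).2 - s2 * c * (k v).1
                        + a * (s4 * c) - b * (s3 * c)); last by ring.
  by rewrite -e1 -e2 -e3 -e4; ring.
have qDZ a z z' : a *: q z + q z' = q (a * z + z').
  by rewrite /q raddfD /= pi_quotmodZ.
have kDZ a u v : a *: u + v = (a * (k u).1 + (k v).1) *: x
                            + (a * (k u).2 + (k v).2) *: y.
  by rewrite {1}(kE u) {1}(kE v) -[X in _ + X]scale1r scaler_comb2 !mul1r.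
have [|||g gE] := @ext2_universal R E (quotmod K) f.
- move=> a u u' v; rewrite {2 3}/f qDZ.
  rewrite (fE _ v _ _ _ _ (kDZ a u u') (kE v)).
  by congr q; ring.
- move=> a u v v'; rewrite {2 3}/f qDZ.
  rewrite (fE u _ _ _ _ _ (kE u) (kDZ a v v')).
  by congr q; ring.
- by move=> u; rewrite /f mulrC subrr /q raddf0.
have : g (t *: wedge x y) = 0 by rewrite txy0 linear0.
rewrite linearZ /= gE (fE _ _ 1 0 0 1); last 2 first.
- by rewrite scale1r scale0r addr0.
- by rewrite scale1r scale0r add0r.
rewrite mulr1 mul0r subr0 -[t *: _]addr0 -(raddf0 \pi_(quotmod K)).
rewrite (qDZ t 1 0) mulr1 addr0.
by move/pi_quotmodP; rewrite subr0 => /span2_setP[s [s' ->]];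
  exists s; rewrite scaler0 addr0.
Qed.

End Wedge.
(** * Oriented submodules given by a pair of generators *)

Section OrientedPair.

Variables (R : finComNzRingType) (V : finLmodType R).

Definition oriented_pair (x y : V) : oriented_submodule V :=
  OrientedSubmodule (span2_two_generated x y) (span2_generates x y).

(** An equality of oriented submodules compares orientations living in different
    exterior squares.  Writing it with generators taken inside the module of O
    avoids the transport between the two, and gives a boolean
    predicate on which one can choose. *)
Definition presents (O : oriented_submodule V) (x y : V) : bool :=
  (os_module O == span2 x y) &&
  [exists X : submodule_type (os_module O),
   exists Y : submodule_type (os_module O),
     [&& val X == x, val Y == y & os_orientation O == wedge X Y]].

Lemma presentsP (O : oriented_submodule V) (x y : V) :
  reflect (oriented_pair x y = O) (presents O x y).
Proof.
apply: (iffP andP) => [[]|<-]; last first.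
  split=> //=; apply/existsP; exists (span2_l x y); apply/existsP.
  by exists (span2_r x y); rewrite !eqxx.
case: O => L t e e_gen /= /eqP LE; subst L.
case/existsP=> X /existsP[Y /and3P[/eqP Xx /eqP Yy /eqP eE]]; subst e.
have XE : X = span2_l x y by apply: val_inj; apply: Xx.
have YE : Y = span2_r x y by apply: val_inj; apply: Yy.
subst X Y; rewrite /oriented_pair (bool_irrelevance t (span2_two_generated x y)).
by rewrite (bool_irrelevance e_gen (span2_generates x y)).
Qed.

Lemma span2_comb2_sub (x y : V) (a b c d : R) :
  span2 (a *: x + b *: y) (c *: x + d *: y) \subset span2 x y.
Proof.
apply/subsetP=> v /span2_setP[s [t ->]]; rewrite scaler_comb2.
by apply/span2_setP; do 2!eexists.
Qed.

Lemma comb2_inv (x y : V) (a b c d u : R) : u * (a * d - b * c) = 1 ->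
  let x' := a *: x + b *: y in let y' := c *: x + d *: y in
  x = (u * d) *: x' + (- (u * b)) *: y' /\ y = (- (u * c)) *: x' + (u * a) *: y'.
Proof.
move=> det1 x' y'; rewrite !scaler_comb2; split.
- rewrite -[LHS]addr0 -[X in X + _]scale1r -[X in _ + X](scale0r y) -det1.
  by congr (_ *: _ + _ *: _); ring.
- rewrite -[LHS]add0r -[X in _ + X]scale1r -[X in X + _](scale0r x) -det1.
  by congr (_ *: _ + _ *: _); ring.
Qed.

Lemma span2_comb2 (x y : V) (a b c d u : R) : u * (a * d - b * c) = 1 ->
  span2 (a *: x + b *: y) (c *: x + d *: y) = span2 x y.
Proof.
move=> det1; apply/val_inj/eqP; rewrite eqEsubset span2_comb2_sub /=.
have [xE yE] := comb2_inv x y det1.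
have := span2_comb2_sub (a *: x + b *: y) (c *: x + d *: y)
  (u * d) (- (u * b)) (- (u * c)) (u * a).
by rewrite -xE -yE.
Qed.

(** Both the invariance under SL_2 and the rescaling of an orientation by a unit
    are instances; u is the inverse of the determinant. *)
Lemma presents_comb2 (x y : V) (a b c d u : R) (O : oriented_submodule V) :
    u * (a * d - b * c) = 1 -> os_module O = span2 x y ->
    (forall X Y : submodule_type (os_module O), val X = x -> val Y = y ->
      os_orientation O = (a * d - b * c) *: wedge X Y) ->
  presents O (a *: x + b *: y) (c *: x + d *: y).
Proof.
move=> det1 OE eE; apply/andP; split; first by rewrite (span2_comb2 _ _ det1) OE.
have xO : in_submodule (os_module O) x by rewrite OE mem_span2l.
have yO : in_submodule (os_module O) y by rewrite OE mem_span2r.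
pose X : submodule_type (os_module O) := exist _ x xO.
pose Y : submodule_type (os_module O) := exist _ y yO.
apply/existsP; exists (a *: X + b *: Y); apply/existsP; exists (c *: X + d *: Y).
by rewrite !eqxx wedge_comb2 (eE X Y) /=.
Qed.

Lemma oriented_pair_comb2 (x y : V) (a b c d : R) : a * d - b * c = 1 ->
  oriented_pair (a *: x + b *: y) (c *: x + d *: y) = oriented_pair x y.
Proof.
move=> det1; apply/presentsP/(@presents_comb2 _ _ _ _ _ _ 1) => //=.
  by rewrite mul1r.
move=> X Y Xx Yy; rewrite det1 scale1r; congr wedge; exact: val_inj.
Qed.

End OrientedPair.

(** * Pairs with the same oriented submodule *)

Section Classification.

Variables (R : finComUnitRingType) (V : finLmodType R).
Hypothesis R_chain : chain_ring R.

(** A generator c of the ideal of relation coefficients is a coefficient of some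
    relation a x + b y = 0.  If c = a, then b = t c and the relation reads
    c (x + t y) = 0, so (- y, x + t y) is the required pair; if c = b, then
    a = t c and (x, t x + y) is. *)
Lemma normalize_pair (x y : V) : exists c a1 b1 a2 b2 : R,
  let x1 := a1 *: x + b1 *: y in let y1 := a2 *: x + b2 *: y in
  [/\ a1 * b2 - b1 * a2 = 1, c *: y1 = 0 &
      forall a b, a *: x1 + b *: y1 = 0 ->
        (exists s, a = s * c) /\ (exists s, b = s * c)].
Proof.
pose rels := [seq w <- enum {: R * R} | w.1 *: x + w.2 *: y == 0].
pose s := [seq w.1 | w <- rels] ++ [seq w.2 | w <- rels].
have relP a b : a *: x + b *: y = 0 -> a \in s /\ b \in s.
  move=> ab0; have abr : (a, b) \in rels by rewrite mem_filter mem_enum /= ab0 eqxx.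
  by rewrite !mem_cat (map_f fst abr) (map_f snd abr) orbT.
have s0 : s != [::].
  have [] := relP 0 0; first by rewrite !scale0r addr0.
  by case: (s).
have [c cs cP] := chain_ring_gen R_chain s0.
have [a [b [ab0 cab]]] : exists a b, a *: x + b *: y = 0 /\ (c = a \/ c = b).
  move: cs; rewrite mem_cat => /orP[]/mapP[[a b]];
    rewrite mem_filter => /andP[/eqP ab0 _] cE; exists a, b; split=> //.
  - by left.
  - by right.
have dvd a' b' : a' *: x + b' *: y = 0 ->
    (exists t, a' = t * c) /\ (exists t, b' = t * c).
  by move=> /relP[/cP ? /cP].
have [[ta aE] [tb bE]] := dvd _ _ ab0.
case: cab => cE; subst c.
- exists a, 0, (-1), 1, tb => x1 y1; split=> [||a' b'].
  + by ring.
  + by rewrite scalerDr !scalerA mulr1 [a * tb]mulrC -bE.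
  + rewrite scaler_comb2 => /dvd[[u uE] [v vE]].
    have b'E : b' = u * a by rewrite -uE; ring.
    split; last by exists u.
    by exists (u * tb - v); rewrite mulrBl -vE b'E; ring.
- exists b, 1, 0, ta, 1 => x1 y1; split=> [||a' b'].
  + by ring.
  + by rewrite scalerDr !scalerA mulr1 [b * ta]mulrC -aE.
  + rewrite scaler_comb2 => /dvd[[u uE] [v vE]].
    have b'E : b' = v * b by rewrite -vE; ring.
    split; last by exists v.
    by exists (u - v * ta); rewrite mulrBl -uE b'E; ring.
Qed.

(** The two vectors are expressed in each other, through g (rows (a, b) and
    (d, e)) and back through a matrix with first row (h, k).  Then
    1 - (h a + k d) is a relation coefficient, that is, a multiple v c of c.  By
    locality h a + k d or v c is a unit: in the former case the first column
    (a, d) of g is unimodular, in the latter y = 0 and then x = 0. *)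
Lemma normalized_pair_inj (c : R) (x y x' y' : V) :
    c *: y = 0 ->
    (forall a b, a *: x + b *: y = 0 ->
      (exists s, a = s * c) /\ (exists s, b = s * c)) ->
    oriented_pair x y = oriented_pair x' y' ->
  exists a b d e : R,
    [/\ a * e - b * d = 1, x' = a *: x + b *: y & y' = d *: x + e *: y].
Proof.
move=> cy0 rel eq_xy.
have LE : span2 x y = span2 x' y' := congr1 (@os_module R V) eq_xy.
have /presentsP/andP[_ /existsP[X' /existsP[Y']]] := esym eq_xy.
move=> /and3P[/eqP Xx /eqP Yy /eqP /= wE].
have [a [b XE]] := span2_typeP X'; have [d [e YE]] := span2_typeP Y'.
have xE : x' = a *: x + b *: y by rewrite -Xx XE.
have yE : y' = d *: x + e *: y by rewrite -Yy YE.
have [t tE] : exists t, 1 - (a * e - b * d) = t * c.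
  apply: (@wedge_annihilator _ _ (span2_l x y) (span2_r x y)).
  - exact: span2_typeP.
  - by move=> i j /(congr1 val) /=; apply: rel.
  - by rewrite scalerBl scale1r -wedge_comb2 -XE -YE -wE subrr.
have : in_submodule (span2 x' y') x by rewrite -LE mem_span2l.
case/span2_setP=> h [k xE']; rewrite xE yE scaler_comb2 in xE'.
have x_rel : (1 - (h * a + k * d)) *: x + - (h * b + k * e) *: y = 0.
  by rewrite scalerBl scaleNr scale1r {1}xE' addrAC addrK subrr.
have [[v vE] _] := rel _ _ x_rel.
have [x0|x_neq0] := eqVneq x 0.
  have y0 : y = 0.
    have [|[s sc] _] := rel 1 0; first by rewrite x0 scaler0 scale0r addr0.
    by rewrite -[y]scale1r sc -scalerA cy0 scaler0.
  exists 1, 0, 0, 1; split; first by ring.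
    by rewrite xE x0 y0 !scaler0.
  by rewrite yE x0 y0 !scaler0.
have [u1 [u2 u12]] : exists u1 u2 : R, u1 * a + u2 * d = 1.
  have /(chain_ring_unitD R_chain)/orP[vc_unit|w_unit] :
      v * c + (h * a + k * d) \is a GRing.unit by rewrite -vE subrK unitr1.
    have /andP[_ c_unit] : (v \is a GRing.unit) && (c \is a GRing.unit).
      by rewrite -unitrM.
    have y0 : y = 0 by rewrite -[y]scale1r -(mulVr c_unit) -scalerA cy0 scaler0.
    case/eqP: x_neq0; move: x_rel; rewrite y0 scaler0 addr0 vE => vcx0.
    by rewrite -[x]scale1r -(mulVr vc_unit) -scalerA vcx0 scaler0.
  exists ((h * a + k * d)^-1 * h), ((h * a + k * d)^-1 * k).
  by rewrite -!mulrA -mulrDr mulVr.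
(* Adding t c (- u2, u1) to the second column of g does not affect the images,
   as c y = 0, and adds t c (u1 a + u2 d) = 1 - det g to the determinant. *)
exists a, (b - t * c * u2), d, (e + t * c * u1); split.
- rewrite [LHS](_ : _ = (a * e - b * d) + t * c * (u1 * a + u2 * d)); last by ring.
  by rewrite u12 mulr1 -tE addrC subrK.
- by rewrite xE scalerBl [t * c * _]mulrAC -scalerA cy0 scaler0 subr0.
- by rewrite yE scalerDl [t * c * _]mulrAC -scalerA cy0 scaler0 addr0.
Qed.

Theorem oriented_pair_inj (x y x' y' : V) :
    oriented_pair x y = oriented_pair x' y' ->
  exists a b d e : R,
    [/\ a * e - b * d = 1, x' = a *: x + b *: y & y' = d *: x + e *: y].
Proof.
have [c [a1 [b1 [a2 [b2 [det1 cy0 rel]]]]]] := normalize_pair x y.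
rewrite -(oriented_pair_comb2 x y det1) => /(normalized_pair_inj cy0 rel).
case=> [a [b [d [e [det2 -> ->]]]]]; rewrite !scaler_comb2.
do 4!eexists; split; [|reflexivity|reflexivity].
by rewrite -[RHS]mulr1 -{1}det1 -det2; ring.
Qed.

Theorem oriented_pair_surj (O : oriented_submodule V) :
  exists x y, oriented_pair x y = O.
Proof.
case: O => L L2 w w_gen; have [x [y LE]] := two_generatedP _ L2; subst L.
have /forallP/(_ w)/existsP[a /eqP aE] := span2_generates x y.
have /forallP/(_ (span2_wedge x y))/existsP[b /eqP bE] := w_gen.
(* If the exterior square is zero, a need not be a unit, but u = 1 will do. *)
suff [u [u_unit uE]] : exists u, u \is a GRing.unit /\ w = u *: span2_wedge x y.
  exists (u *: x + 0 *: y), (0 *: x + 1 *: y).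
  apply/presentsP/(@presents_comb2 _ _ _ _ _ _ _ _ u^-1) => //.
    by rewrite mulr1 mulr0 subr0 mulVr.
  move=> X Y Xx Yy; rewrite mulr1 mulr0 subr0 /= uE.
  by congr (u *: wedge _ _); apply: val_inj.
have /(chain_ring_unitD R_chain)/orP[ba_unit|w_unit] :
    b * a + (1 - b * a) \is a GRing.unit by rewrite addrC subrK unitr1.
  by exists a; split=> //; move: ba_unit; rewrite unitrM => /andP[].
have wedge0 : span2_wedge x y = 0.
  rewrite -[LHS]scale1r -(mulVr w_unit) -scalerA scalerBl scale1r -scalerA.
  by rewrite -aE -bE subrr scaler0.
by exists 1; rewrite unitr1 aE wedge0 !scaler0.
Qed.

End Classification.

(** * Matrices and their row spaces *)

Section RowSpace.

Variables (R : finComUnitRingType) (m : nat).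

Lemma det_mx2 (g : 'M[R]_2) :
  \det g = g ord0 ord0 * g ord_max ord_max - g ord0 ord_max * g ord_max ord0.
Proof.
rewrite (expand_det_row g ord0) !big_ord_recl big_ord0 addr0 /cofactor !det_mx11.
rewrite !mxE /= expr0 expr1 mul1r mulN1r mulrN.
by congr (_ * g _ _ - g _ _ * g _ _); apply: val_inj.
Qed.

Lemma row_mulmx2 (g : 'M[R]_2) (M : 'M[R]_(2, m)) (i : 'I_2) :
  row i (g *m M) = g i ord0 *: row ord0 M + g i ord_max *: row ord_max M.
Proof.
apply/rowP=> j; rewrite !mxE !big_ord_recl big_ord0 addr0.
by congr (_ + g _ _ * M _ _); apply: val_inj.
Qed.

Definition mx2_rows (x y : 'rV[R]_m) : 'M[R]_(2, m) :=
  \matrix_(i, j) (if i == ord0 then x else y) ord0 j.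

Lemma row0_mx2_rows (x y : 'rV[R]_m) : row ord0 (mx2_rows x y) = x.
Proof. by apply/rowP=> j; rewrite !mxE. Qed.

Lemma row1_mx2_rows (x y : 'rV[R]_m) : row ord_max (mx2_rows x y) = y.
Proof. by apply/rowP=> j; rewrite !mxE. Qed.

Lemma mx2_rowsE (M N : 'M[R]_(2, m)) :
  row ord0 M = row ord0 N -> row ord_max M = row ord_max N -> M = N.
Proof.
move=> e0 e1; apply/row_matrixP=> i.
have [->//|i0] := eqVneq i ord0; suff -> : i = ord_max by [].
by apply: val_inj; case: i i0 => [[|[|i]]].
Qed.

Lemma oriented_rowspace_SL2 (g : 'M[R]_2) (M : 'M[R]_(2, m)) :
  \det g = 1 -> oriented_rowspace (g *m M) = oriented_rowspace M.
Proof.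
rewrite det_mx2 => /(oriented_pair_comb2 (row ord0 M) (row ord_max M)).
by rewrite -!row_mulmx2.
Qed.

Theorem SL2_quot_oriented_bijection (R_chain : chain_ring R) :
  exists f : SL2_quot R m -> oriented_submodule 'rV[R]_m,
    (forall M, f (\pi_(SL2_quot R m) M) = oriented_rowspace M) /\ bijective f.
Proof.
pose f (q : SL2_quot R m) := oriented_rowspace (repr q).
have fpi M : f (\pi_(SL2_quot R m) M) = oriented_rowspace M.
  rewrite /f; set q := \pi_(SL2_quot R m) M.
  have : \pi_(SL2_quot R m) M == \pi_(SL2_quot R m) (repr q) by rewrite reprK.
  by case/SL2_quotP=> g g1 ->; apply: oriented_rowspace_SL2.
have surj O : exists M : 'M[R]_(2, m), presents O (row ord0 M) (row ord_max M).
  have [x [y xyO]] := oriented_pair_surj R_chain O.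
  by exists (mx2_rows x y); apply/presentsP; rewrite row0_mx2_rows row1_mx2_rows.
pose h O := \pi_(SL2_quot R m) (xchoose (surj O)).
have hK : cancel h f.
  by move=> O; rewrite fpi; apply/presentsP/(xchooseP (surj O)).
have f_inj : injective f.
  move=> q1 q2; rewrite -[q1]reprK -[q2]reprK !fpi.
  move=> /(oriented_pair_inj R_chain)[a [b [d [e [det1 xE yE]]]]].
  apply/eqP/SL2_quotP.
  pose g : 'M[R]_2 := \matrix_(i, j)
    if i == ord0 then (if j == ord0 then a else b)
    else (if j == ord0 then d else e).
  exists g; first by rewrite det_mx2 !mxE.
  by apply: mx2_rowsE; rewrite row_mulmx2 !mxE; [apply: xE|apply: yE].
exists f; split=> //; exists h => //.
by move=> q; apply: f_inj; rewrite hK.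
Qed.

End RowSpace.

(** * The ring Z/p^r *)

(** By Bezout, an element a is associate to gcd(a, p^r), a power of p. *)
Lemma Zp_pexp_chain (p r : nat) : prime p -> (1 <= r)%N -> chain_ring 'Z_(p ^ r).
Proof.
move=> p_prime r_ge1; set n := (p ^ r)%N.
have n_gt1 : (1 < n)%N by rewrite -[1%N](exp1n r) ltn_exp2r // prime_gt1.
have assoc (a : 'Z_n) : exists i (s t : 'Z_n), a = s * (p ^ i)%:R /\ (p ^ i)%:R = t * a.
  have /(dvdn_pfactor _ _ p_prime)[i _ dE] := dvdn_gcdl n a.
  have [|u _ /dvdnP[v uv]] := @Bezoutl n a; first exact: ltnW.
  exists i, (a %/ gcdn n a)%:R, (- u%:R); rewrite -dE; split.
    by rewrite -natrM divnK ?dvdn_gcdr // natr_Zp.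
  apply/eqP; rewrite mulNr -addr_eq0 -[X in _ * X]natr_Zp -natrM -natrD uv.
  by rewrite natrM pchar_Zp ?mulr0.
move=> a b; have [i [s [t [aE tE]]]] := assoc a.
have [j [s' [t' [bE tE']]]] := assoc b.
have pow k l : (k <= l)%N -> (p ^ l)%:R = (p ^ (l - k))%:R * (p ^ k)%:R :> 'Z_n.
  by move=> kl; rewrite -natrM -expnD subnK.
have [ij|/ltnW ji] := leqP i j.
- right; exists (s' * (p ^ (j - i))%:R * t).
  by rewrite bE (pow i j) // tE !mulrA.
- left; exists (s * (p ^ (i - j))%:R * t').
  by rewrite aE (pow j i) // tE' !mulrA.
Qed.

Theorem theorem5p4 (p r m : nat) (p_prime : prime p) (r_ge1 : (1 <= r)%N) :
  exists f : SL2_quot 'Z_(p ^ r) m ->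
             oriented_submodule 'rV['Z_(p ^ r)]_m,
    (forall M : 'M['Z_(p ^ r)]_(2, m),
       f (\pi_(SL2_quot 'Z_(p ^ r) m) M) = oriented_rowspace M) /\
    bijective f.
Proof. exact: SL2_quot_oriented_bijection (Zp_pexp_chain p_prime r_ge1). Qed.
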